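(* Let $\Gamma$ be a numerical monoid, let $s \in \mathbb{N}\setminus\Gamma$, and let $S_\Gamma^s$ be the associated Leamer monoid. Then the elasticity of $S_\Gamma^s$ is infinite: $\rho(S_\Gamma^s) = \infty$.
   Context: $\mathbb{N}$ contains $0$. A numerical monoid is an additive submonoid $\Gamma\subseteq\mathbb{N}$ (containing $0$) with finite complement. For $s\in\mathbb{N}\setminus\Gamma$ the Leamer monoid is $$S_\Gamma^s=\{(0,0)\}\cup\{(x,n): n\ge 1,\ \{x,x+s,x+2s,\ldots,x+ns\}\subset\Gamma\}\subset\mathbb{N}^2,$$ a monoid under componentwise addition. An atom (irreducible element) is a nonzero element that is not a sum of two nonzero elements of $S_\Gamma^s$; $\mathcal{A}(S_\Gamma^s)$ is the set of atoms. The set of lengths of $(x,n)\in S_\Gamma^s$ is $\mathcal{L}(x,n)=\{r : (x,n)=\sum_{i=1}^r (x_i,n_i),\ (x_i,n_i)\in\mathcal{A}(S_\Gamma^s)\}$. Put $\ell(x,n)=\min\mathcal{L}(x,n)$, $L(x,n)=\max\mathcal{L}(x,n)$, and for nonzero $(x,n)$ put $\rho(x,n)=L(x,n)/\ell(x,n)$. The elasticity of $S_\Gamma^s$ is $\rho(S_\Gamma^s)=\sup\{\rho(x,n)\}$, the supremum over all nonzero $(x,n)\in S_\Gamma^s$. *)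

(* Defs.v *)
From HB Require Import structures.
From mathcomp Require Import all_boot all_order all_algebra.
From mathcomp Require Import all_classical all_reals ereal.

Set Implicit Arguments.
Unset Strict Implicit.
Unset Printing Implicit Defensive.

Import Order.TTheory GRing.Theory Num.Theory.
Local Open Scope classical_set_scope.
Local Open Scope ring_scope.

Definition submonoid (V : nmodType) (M : set V) : Prop :=
  M 0 /\ forall x y, M x -> M y -> M (x + y).

Definition numerical_monoid (G : set nat) : Prop :=
  submonoid G /\ finite_set (~` G).

Definition leamer (G : set nat) (s : nat) : set (nat * nat) :=
  [set p | p = (0, 0)%N \/
    (1 <= p.2)%N /\ forall i : nat, (i <= p.2)%N -> G (p.1 + i * s)%N].

Section Factorizations.
Variables (V : nmodType) (M : set V).

Definition atoms : set V :=
  [set a | [/\ M a, a <> 0 &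
    ~ exists b c, [/\ M b, M c, b <> 0, c <> 0 & a = b + c]]].

Definition lengths (x : V) : set nat :=
  [set r | exists a : 'I_r -> V, (forall i, atoms (a i)) /\ x = \sum_(i < r) a i].

(* The minimum and maximum of [lengths x]; the value is 0 if there is none,
   which does not occur in a Leamer monoid (see [leamer_min_lengthP] and
   [leamer_max_lengthP]). *)
Definition min_length (x : V) : nat := xget 0%N (lengths x `&` lbound (lengths x)).
Definition max_length (x : V) : nat := xget 0%N (lengths x `&` ubound (lengths x)).

Variable R : realType.

Definition element_elasticity (x : V) : R := (max_length x)%:R / (min_length x)%:R.

Definition elasticity : \bar R :=
  ereal_sup [set (element_elasticity x)%:E | x in M `\ 0].

End Factorizations.

Arguments elasticity {V} M R.

Section LeamerFacts.
Variables (G : set nat) (s : nat).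
Hypothesis hG : numerical_monoid G.

Lemma leamer_submonoid : submonoid (leamer G s).
Proof.
split; first by left.
case: hG => -[_ GD] _ p q.
case=> [->|[p1 hp]]; first by rewrite add0r.
case=> [->|[q1 hq]]; first by rewrite addr0; right.
right; split=> [|i hi /=]; first exact: leq_trans p1 (leq_addr _ _).
have [le_ip|lt_pi] := leqP i p.2.
  rewrite [X in G X](_ : _ = (p.1 + i * s) + (q.1 + 0 * s))%N.
    by apply: GD; [exact: hp|exact: hq].
  by rewrite mul0n addn0 addnAC.
rewrite [X in G X](_ : _ = (p.1 + p.2 * s) + (q.1 + (i - p.2) * s))%N.
  by apply: GD; [exact: hp|apply: hq; rewrite leq_subLR].
by rewrite addnACA -mulnDl subnKC // ltnW.
Qed.

Lemma leamer_snd_gt0 p : leamer G s p -> p <> 0 -> (0 < p.2)%N.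
Proof. by case=> [-> //|[]]. Qed.

Lemma leamer_lengths_ub p r : lengths (leamer G s) p r -> (r <= p.2)%N.
Proof.
case=> a [ha ->].
suff -> : (\sum_(i < r) a i).2 = (\sum_(i < r) (a i).2)%N.
  rewrite -[leqLHS]card_ord -sum1_card; apply: leq_sum => i _.
  by have [Sa a0 _] := ha i; exact: leamer_snd_gt0.
by elim/big_rec2: _ => // i x y _ <-.
Qed.

Lemma leamer_lengths_neq0 p : leamer G s p -> lengths (leamer G s) p !=set0.
Proof.
have [n] := ubnP p.2; elim: n p => // n IHn p ltpn Sp.
have [->|/eqP p0] := eqVneq p 0.
  by exists 0%N, (fun=> 0); split=> [[]//|]; rewrite big_ord0.
have [[b [c [Sb Sc b0 c0 pE]]]|irr] :=
    pselect (exists b c, [/\ leamer G s b, leamer G s c, b <> 0, c <> 0 & p = b + c]).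
  have b1 := leamer_snd_gt0 Sb b0; have c1 := leamer_snd_gt0 Sc c0.
  have p2E : p.2 = (b.2 + c.2)%N by rewrite pE.
  have [] // := IHn b.
    by apply: leq_trans (ltpn : (p.2 <= n)%N); rewrite p2E -addn1 leq_add2l.
  move=> r1 [a1 [h1 e1]].
  have [] // := IHn c.
    by apply: leq_trans (ltpn : (p.2 <= n)%N); rewrite p2E -add1n leq_add2r.
  move=> r2 [a2 [h2 e2]].
  exists (r1 + r2)%N, (fun i => match fintype.split i with inl j => a1 j | inr j => a2 j end).
  split; first by move=> i; case: (fintype.split i).
  rewrite big_split_ord /= pE e1 e2; congr (_ + _).
    by apply: eq_bigr => i _; rewrite (unsplitK (inl i)).
  by apply: eq_bigr => i _; rewrite (unsplitK (inr i)).
by exists 1%N, (fun=> p); split=> [i|]; [split|rewrite big_ord1].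
Qed.

Let xget_in (T : choiceType) (x0 : T) (A : set T) : A !=set0 -> A (xget x0 A).
Proof. by case=> x Ax; case: xgetP => // /(_ x). Qed.

Lemma leamer_min_lengthP p (L := lengths (leamer G s) p) :
  leamer G s p -> (L `&` lbound L) (min_length (leamer G s) p).
Proof.
move=> /leamer_lengths_neq0 [r Lr]; apply: xget_in.
have exL : exists m, `[< L m >] by exists r; apply/asboolP.
have [m /asboolP Lm mP] := ex_minnP exL.
by exists m; split=> // k Lk; apply: mP; apply/asboolP.
Qed.

Lemma leamer_max_lengthP p (L := lengths (leamer G s) p) :
  leamer G s p -> (L `&` ubound L) (max_length (leamer G s) p).
Proof.
move=> /leamer_lengths_neq0 [r Lr]; apply: xget_in.
have exL : exists m, `[< L m >] by exists r; apply/asboolP.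
have ubL m : `[< L m >] -> (m <= p.2)%N by move=> /asboolP /leamer_lengths_ub.
have [m /asboolP Lm mP] := ex_maxnP exL ubL.
by exists m; split=> // k Lk; apply: mP; apply/asboolP.
Qed.

End LeamerFacts.

(* Main.v *)
Require Import Defs.
From mathcomp Require Import all_boot all_order all_algebra.
From mathcomp Require Import all_classical all_reals ereal.
From mathcomp Require Import zify.

(** Call the column [x] infinite when [x + i * s] lies in [G] for all [i]; let
[x] be the least infinite column, which is positive because [s] is not in [G].
If [(x, n)] decomposes, both summands lie in nonzero columns smaller than [x],
which are finite, so [n] is bounded: [(x, n)] is an atom for all [n > N]. All
elements of height 1 are atoms as well, whence
[k (x, N + 1) = ((k - 1) x, 1) + (x, k (N + 1) - 1)]
has factorizations of lengths [k] and 2, for every [k >= 2]. *)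

Set Implicit Arguments.
Unset Strict Implicit.
Unset Printing Implicit Defensive.

Import Order.TTheory GRing.Theory Num.Theory.
Local Open Scope classical_set_scope.

Lemma pair_mulrn (U V : nmodType) (u : U) (v : V) k :
  ((u, v) *+ k = (u *+ k, v *+ k) :> U * V)%R.
Proof. by elim: k => // k IHk; rewrite !mulrS IHk. Qed.

Section Leamer.
Variables (G : set nat) (s : nat).
Hypothesis hG : numerical_monoid G.

Lemma numerical_monoid_ge : exists B, forall x, B <= x -> G x.
Proof.
case: hG => _ /finite_seqP [r rE]; exists (\max_(i <- r) i).+1 => x ltx.
apply: contrapT => nGx; have : [set` r] x by rewrite -rE.
by rewrite /= => xr; move: ltx; rewrite ltnNge leq_bigmax_seq.
Qed.

(** Nonzero elements have height at least 1 and heights add, so a sum of two of them has height at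
    least 2. *)
Lemma leamer_height1_atom x : leamer G s (x, 1) -> atoms (leamer G s) (x, 1).
Proof.
move=> Sx; split=> // -[b [c [Sb Sc b0 c0 [_]]]].
have := leamer_snd_gt0 Sb b0; have := leamer_snd_gt0 Sc c0.
rewrite /GRing.add /=; lia.
Qed.

Hypothesis hs : ~ G s.

(** A nonzero element in column 0 would put [0 + 1 * s] in [G]. Hence both summands of a
    decomposition lie in strictly smaller columns. *)
Lemma leamer_fst_gt0 p : leamer G s p -> p <> 0%R -> 0 < p.1.
Proof.
case: p => -[|x] n // [[->]//|[/= n1 Gp]] _.
by case: hs; have := Gp 1 n1; rewrite add0n mul1n.
Qed.

Definition infinite_column x := forall i, G (x + i * s).

Lemma infinite_column_atoms :
  exists x N, 0 < x /\ forall n, N < n -> atoms (leamer G s) (x, n).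
Proof.
have s0 : 0 < s by rewrite lt0n; apply/eqP => s0; apply: hs; rewrite s0; case: hG => -[].
have [B GB] := numerical_monoid_ge.
have exx : exists x, `[< infinite_column x >].
  by exists B; apply/asboolP => i; apply: GB; rewrite leq_addr.
have [x /asboolP colx minx] := ex_minnP exx.
(* If [B < m], the terms [a + i * s] with [i <= m] are in [G] by membership, the later ones because
   [B < i <= i * s]; column [a] would be infinite, against the minimality of [x]. *)
have small a m : a < x -> leamer G s (a, m) -> m <= B.
  move=> ltax [[_ ->]//|[/= m1 Ga]]; rewrite leqNgt; apply/negP => ltBm.
  suff /asboolP/minx : infinite_column a by lia.
  move=> i; have [leim|ltmi] := leqP i m; first exact: Ga.
  by apply: GB; nia.
have x0 : 0 < x.
  rewrite lt0n; apply/eqP => x0; apply: hs.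
  by have := colx 1; rewrite x0 add0n mul1n.
(* Two summands of height at most [B] reach height at most [B + B]. *)
exists x, (B + B); split=> // n ltn.
split; [by right; split=> /=; [lia|move=> i _; exact: colx] | by case; lia |].
case=> -[a m] [] [b l] [Sa Sb a0 b0 [xE nE]].
have := leamer_fst_gt0 Sa a0; have := leamer_fst_gt0 Sb b0.
move: xE nE; rewrite /GRing.add /= => xE nE bpos apos.
have : m <= B by apply: small Sa; lia.
have : l <= B by apply: small Sb; lia.
lia.
Qed.

Lemma leamer_lengths_unbounded k : 1 < k ->
  exists p, [/\ leamer G s p, p <> 0%R,
    lengths (leamer G s) p 2 & lengths (leamer G s) p k].
Proof.
move=> k1; have [x [N [x0 atomx]]] := infinite_column_atoms.
have [Sx _ _] := atomx N.+1 (leqnn _).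
have [S0 SD] := leamer_submonoid s hG.
have [[G0 GD] _] := hG.
have GM j y : G y -> G (j * y).
  by move=> Gy; elim: j => // j IHj; rewrite mulSn; exact: GD.
have [Gx Gxs] : G x /\ G (x + s).
  case: Sx => [[xE]|[_ Gx]]; first by rewrite xE in x0.
  by split; [have := Gx 0; rewrite addn0|have := Gx 1; rewrite mul1n]; exact.
have atom1 : atoms (leamer G s) (k.-1 * x, 1).
  apply: leamer_height1_atom; right; split=> // -[|[|//]] _ /=.
    by rewrite addn0; exact: GM.
  (* One of the [k.-1] copies of [x] absorbs [s], which is not itself in [G]. *)
  suff -> : k.-1 * x + 1 * s = k.-2 * x + (x + s) by apply: GD => //; exact: GM.
  by case: k k1 => [|[|k]] //= _; lia.
have atom2 : atoms (leamer G s) (x, (k * N.+1).-1) by apply: atomx; nia.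
have sumE : ((k.-1 * x, 1) + (x, (k * N.+1).-1) = (k * x, k * N.+1) :> nat * nat)%R.
  by rewrite /GRing.add /=; congr (_, _); rewrite /GRing.add /=; nia.
exists (k * x, k * N.+1); split.
- by rewrite -sumE; apply: SD; [case: atom1|case: atom2].
- by case; nia.
- exists (fun i => if i == ord0 then (k.-1 * x, 1) else (x, (k * N.+1).-1)).
  split=> [i|]; first by case: ifP.
  by rewrite big_ord_recl big_ord1 /= -sumE.
- exists (fun=> (x, N.+1)); split=> [_|]; first exact: atomx.
  rewrite sumr_const card_ord pair_mulrn.
  by congr (_, _); rewrite -mulr_natr natn mulnC.
Qed.

Lemma leamer_elasticity_ge (R : realType) k : 1 < k ->
  exists2 p, (leamer G s `\ 0%R) p &
    (k%:R / 2 <= element_elasticity (leamer G s) R p)%R.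
Proof.
move=> /leamer_lengths_unbounded [p [Sp p0 L2 Lk]]; exists p => //.
have [Lmin /(_ _ L2) min2] := leamer_min_lengthP Sp.
have [_ /(_ _ Lk) maxk] := leamer_max_lengthP Sp.
(* Since the inverse of 0 is 0, this must be excluded before inverting [min2]; only the zero element
   has length 0. *)
have min0 : 0 < min_length (leamer G s) p.
  rewrite lt0n; apply/eqP => min0; move: Lmin; rewrite min0 => -[a [_ pE]].
  by apply: p0; rewrite pE big_ord0.
rewrite /element_elasticity ler_pM ?ler_nat ?invr_ge0 ?ler0n //.
by rewrite lef_pV2 ?posrE ?ltr0n // ler_nat.
Qed.

End Leamer.

Theorem theorem3p2 (R : realType) (G : set nat) (s : nat)
    (hG : numerical_monoid G) (hs : ~ G s) :
  elasticity (leamer G s) R = +oo%E.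
Proof.
apply: eq_infty => t.
(* The Archimedean bound gives [t <= k / 2], and the shift by 2 ensures [1 < k]. *)
pose k := (Num.bound `|t * 2|%R).+2.
have [//|p Sp kp] := leamer_elasticity_ge hG hs R (k := k).
apply: (@le_trans _ _ (element_elasticity (leamer G s) R p)%:E).
  rewrite lee_fin; apply: le_trans kp; rewrite ler_pdivlMr ?ltr0n //.
  apply: le_trans (ler_norm _) _; apply/ltW/(lt_trans (archi_boundP _)) => //.
  by rewrite ltr_nat ltnS leqnSn.
by apply: ereal_sup_ubound; exists p.
Qed.
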